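(* Let $n\ge 0$. The excess of the total number of parts in all partitions in $\mathcal A_\nu(n)$ over the total number of parts in all partitions in $\mathcal B_\nu(n)$ equals the sum of the number of odd parts minus $1$ over all partitions in $\mathcal A_\nu(n)$, i.e. $\sum_{\pi\in\mathcal A_\nu(n)}(\ell_o(\pi)-1)$, or equivalently the sum of ranks over all odd Ferrers diagrams in $\mathcal A_{\nu,2}(n)$, i.e. $\sum_{F\in\mathcal A_{\nu,2}(n)}\operatorname{rank}(F)$. If $n\ge 1$, this excess is non-negative.
   Context: A partition of $n$ is a finite non-increasing sequence of positive integers (parts) with sum $n$ (the empty partition is the only partition of $0$). $\ell(\pi)$ is the number of parts and $\ell_o(\pi)$ the number of odd parts of $\pi$, counted with multiplicity. $\mathcal A_\nu(n)$ is the set of partitions of $n$ whose even parts are distinct and such that, if $m$ occurs as a part, then so does every positive even number less than $m$. $\mathcal B_\nu(n)$ is the set of non-empty partitions of $n$ into distinct parts in which each odd part is less than twice the smallest part, where, contrary to the usual convention, zero is allowed as a part (at most once); a part equal to $0$ is counted in the number of parts and makes $0$ the smallest part. For example $(6,4,2)$ and $(6,4,2,0)$ are different elements, with three and four parts respectively. Equivalently, the generating function by number of parts ($z$) and size ($q$) is $\sum_{k\ge 0} zq^k(-zq^{k+1};q)_k(-zq^{2k+2};q^2)_\infty$, where $(a;q)_n=\prod_{j=0}^{n-1}(1-aq^j)$ for $n\in\mathbb N_0\cup\{\infty\}$. An odd Ferrers diagram is identified with a pair $F=(k,\lambda)$, where $k\ge 0$ is an integer and $\lambda$ is a partition into odd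 parts all at most $2k-1$ (so $\lambda=\emptyset$ if $k=0$): it is the diagram whose first row consists of $k$ boxes filled with $1$, and whose remaining rows are, for each part $\lambda_i$, a left-justified row of $(\lambda_i+1)/2$ boxes, the first filled with $1$ and the others with $2$. Its size is $k+|\lambda|$, and its rank is $\operatorname{rank}(F)=k-\ell(\lambda)-1$ (number of columns minus number of rows). $\mathcal A_{\nu,2}(n)$ is the set of odd Ferrers diagrams $(k,\lambda)$ of size $n$ in which $\lambda$ has distinct parts (with generating function $\sum_{k\ge0}(-q;q^2)_kq^k$). *)

(* Defs.v *)
From mathcomp Require Import all_boot all_order all_algebra.

Set Implicit Arguments.
Unset Strict Implicit.
Unset Printing Implicit Defensive.

Definition is_partition (n : nat) (p : seq nat) : bool :=
  [&& sorted geq p, all (leq 1) p & sumn p == n].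

Definition is_Anu (n : nat) (p : seq nat) : bool :=
  [&& is_partition n p,
      uniq [seq m <- p | ~~ odd m]
    & all (fun m => [forall j : 'I_m, (0 < j) && ~~ odd j ==> (val j \in p)]) p].

(* The parts are listed in decreasing order, so that [last] is the smallest
   one; [gtn] makes them distinct, and 0 is not excluded. *)
Definition is_Bnu (n : nat) (p : seq nat) : bool :=
  [&& p != [::], sorted gtn p, sumn p == n
    & all (fun m => odd m ==> (m < 2 * last 0 p)) p].

(* An odd Ferrers diagram is the pair (k, lambda) of the length of its first
   row and of the partition whose part m stands for a row with entries
   1, 2, ..., 2 of sum m.  For k = 0 the truncated bound 2 * k - 1 is 0, which
   forces lambda to be empty. *)
Definition is_odd_ferrers (n : nat) (F : nat * seq nat) : bool :=
  let: (k, l) := F in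
  [&& is_partition (sumn l) l, all odd l, all (geq (2 * k - 1)) l
    & k + sumn l == n].

Definition is_Anu2 (n : nat) (F : nat * seq nat) : bool :=
  is_odd_ferrers n F && uniq F.2.

Definition odd_ferrers_rank (F : nat * seq nat) : int :=
  (F.1%:Z - (size F.2)%:Z - 1)%R.

(* Bounded search spaces; the lemmas [mem_Anu], [mem_Bnu] and [mem_Anu2] below
   show that no object is lost. *)
Definition bounded_seqs (n b : nat) : seq (seq nat) :=
  [seq map val (s : seq 'I_b) | s : n.-bseq 'I_b].

Definition Anu (n : nat) : seq (seq nat) :=
  [seq p <- bounded_seqs n n.+1 | is_Anu n p].

Definition Bnu (n : nat) : seq (seq nat) :=
  [seq p <- bounded_seqs n.+1 n.+1 | is_Bnu n p].

Definition Anu2 (n : nat) : seq (nat * seq nat) :=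
  [seq F <- [seq (k, l) | k <- iota 0 n.+1, l <- bounded_seqs n n.+1]
     | is_Anu2 n F].

Definition parts_excess (n : nat) : int :=
  (\sum_(p <- Anu n) (size p)%:Z - \sum_(p <- Bnu n) (size p)%:Z)%R.

Lemma mem_bounded_seqs n b p :
  (p \in bounded_seqs n b) = (size p <= n) && all (gtn b) p.
Proof.
apply/imageP/andP => [[s _ ->]|[sz lt_b]].
  rewrite size_map size_bseq; split=> //.
  by apply/allP=> _ /mapP[i _ ->]; apply: ltn_ord.
have sz' : size (pmap insub p : seq 'I_b) <= n.
  by rewrite size_pmap_sub (leq_trans (count_size _ _)).
exists (Bseq sz') => //=; rewrite -[LHS]map_id; move: lt_b {sz sz'}.
elim: p => //= m p IHp /andP[m_b p_b].
by rewrite insubT /= -IHp // map_id.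
Qed.

Lemma bounded_seqs_uniq n b : uniq (bounded_seqs n b).
Proof.
rewrite map_inj_uniq ?enum_uniq // => s t /(inj_map val_inj) st.
exact/val_inj.
Qed.

Lemma all_leq_sumn p : all (gtn (sumn p).+1) p.
Proof.
elim: p => //= m p IHp; rewrite ltnS leq_addr /=.
by apply: sub_all IHp => j /=; rewrite !ltnS => /leq_trans; apply; apply: leq_addl.
Qed.

Lemma size_leq_sumn p : all (leq 1) p -> size p <= sumn p.
Proof.
elim: p => //= m p IHp /andP[m_gt0 /IHp le_p].
by rewrite -add1n leq_add.
Qed.

Lemma size_leq_sumn_gtn p : sorted gtn p -> size p <= (sumn p).+1.
Proof.
elim: p => // m [|j p] IHp //= /andP[lt_jm /IHp /= le_p].
rewrite ltnS; apply: leq_trans le_p _; rewrite -add1n leq_add2r.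
exact: leq_ltn_trans lt_jm.
Qed.

Lemma partition_bounded n p :
  is_partition n p -> p \in bounded_seqs n n.+1.
Proof.
case/and3P=> _ p_gt0 /eqP <-.
by rewrite mem_bounded_seqs size_leq_sumn ?all_leq_sumn.
Qed.

Lemma mem_Anu n p : (p \in Anu n) = is_Anu n p.
Proof.
rewrite mem_filter andb_idr // => /and3P[part_p _ _].
exact: partition_bounded.
Qed.

Lemma Anu_uniq n : uniq (Anu n).
Proof. exact/filter_uniq/bounded_seqs_uniq. Qed.

Lemma mem_Bnu n p : (p \in Bnu n) = is_Bnu n p.
Proof.
rewrite mem_filter andb_idr // => /and4P[_ srt_p /eqP <- _].
by rewrite mem_bounded_seqs size_leq_sumn_gtn ?all_leq_sumn.
Qed.

Lemma Bnu_uniq n : uniq (Bnu n).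
Proof. exact/filter_uniq/bounded_seqs_uniq. Qed.

Lemma mem_Anu2 n F : (F \in Anu2 n) = is_Anu2 n F.
Proof.
rewrite mem_filter andb_idr //; case: F => k l.
case/andP=> /and4P[/and3P[_ l_gt0 _] _ _ /eqP def_n] _.
apply: allpairs_f; first by rewrite mem_iota ltnS -def_n leq_addr.
have le_ln : sumn l <= n by rewrite -def_n leq_addl.
rewrite mem_bounded_seqs (leq_trans (size_leq_sumn l_gt0)) //=.
by apply: sub_all (all_leq_sumn l) => j /=; rewrite !ltnS => /leq_trans->.
Qed.

Lemma Anu2_uniq n : uniq (Anu2 n).
Proof.
apply: filter_uniq; apply: allpairs_uniq; rewrite ?iota_uniq ?bounded_seqs_uniq //.
by move=> [k l] [k' l'] _ _ [-> ->].
Qed.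

(* Main.v *)
Require Import Defs.
From mathcomp Require Import all_boot all_order all_algebra.
From mathcomp Require Import zify.
Import Order.TTheory GRing.Theory Num.Theory.

(** All three families are encoded by the same objects: finite words in the
letters true and false, where the weight of a word of length [k] is [k] plus
the sum of [2 * c - 1] over the positions [c] (counted from 1) of its true
letters.

- An odd Ferrers diagram [(k, l)] with distinct parts is the word of length
  [k] whose true positions are the [c] with [2 * c - 1] in [l].  Its rank is
  the number of false letters minus 1.
- A partition in [Anu] is determined by the parities of its parts, read from
  the largest to the smallest: its even parts are exactly [2, 4, .., 2 * N],
  and an odd part followed by [e] even parts has to be [2 * e + 1].  With true
  for even, this is a word whose length is the number of parts.  An even part
  [2 * e] counts itself among the [e] even parts from its position on, so
  summing over positions instead of parts gives the weight above.
- The elements of [Bnu] with [N + 1] parts correspond to the words with [N]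
  true letters.  Prepending a letter to such a word adds [2 * N + 1] to its
  weight if the letter is false and [2 * N + 2] if it is true.  On the other
  side, [bnu_step] adds either 1 to the smallest part and 2 to all others, or
  it adds a part and increases the sum by twice the previous number of parts.
  The two moves have disjoint images, which together cover everything except the
  one-part partition [0] (lemmas [first_bit_bnu_step] and
  [ascending_bnu_inv]).

Hence, over the words of weight [n], the parts of [Anu] contribute the length
and those of [Bnu] the number of true letters plus 1.  The difference is the
number of false letters minus 1, which is both the number of odd parts minus 1
and the rank.  A word contributes a negative amount, -1, only if all its
letters are true; its weight is then [k * (k + 1)], so for a given [n] there
is at most one.  When it exists and [n > 0], then [n >= 2] and the word of [n]
false letters, of weight [n], contributes [n - 1 >= 1]. *)

(** * Words and their weights *)

Lemma sumn_map_add2 s : sumn (map (addn 2) s) = sumn s + 2 * size s.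
Proof. by elim: s => //= m s ->; lia. Qed.

(** A prepended letter shifts every position by one, so these are the numbers
[2 * c - 1] for the positions [c] of the true letters, in decreasing order. *)
Fixpoint odd_parts (b : bitseq) : seq nat :=
  if b is x :: b' then map (addn 2) (odd_parts b') ++ nseq x 1 else [::].

Definition ones (b : bitseq) := count id b.

Definition zeros (b : bitseq) := count negb b.

Definition weight (b : bitseq) := size b + sumn (odd_parts b).

Lemma ones_zeros b : ones b + zeros b = size b.
Proof. exact: count_predC. Qed.

Lemma size_odd_parts b : size (odd_parts b) = ones b.
Proof.
elim: b => //= x b; rewrite size_cat size_map size_nseq /ones => ->.
by rewrite addnC.
Qed.

Lemma weight_cons x b :
  weight (x :: b) = weight b + 2 * ones b + 1 + x.
Proof.
rewrite /weight /= sumn_cat sumn_map_add2 sumn_nseq size_odd_parts; lia.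
Qed.

(** A word is no longer than its weight, so the length bound loses nothing. *)
Definition words (n : nat) : seq bitseq :=
  [seq b <- [seq val s | s : n.-bseq bool] | weight b == n].

Lemma mem_words n b : (b \in words n) = (weight b == n).
Proof.
rewrite mem_filter andb_idr // => /eqP def_n.
have sz_b : size b <= n by rewrite -def_n leq_addr.
by apply/imageP; exists (Bseq sz_b).
Qed.

Lemma words_uniq n : uniq (words n).
Proof. by rewrite filter_uniq // map_inj_uniq ?enum_uniq //; apply: val_inj. Qed.

(** A weight-preserving bijection from words turns a sum over one of the
three families into a sum over [words n], where the sums can be compared term
by term. *)
Lemma big_words (T : eqType) (n : nat) (f : bitseq -> T) (r : seq T)
    (F : T -> int) :
  injective f -> uniq r ->
  (forall p, p \in r <-> exists2 b, weight b = n & f b = p) ->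
  (\sum_(p <- r) F p = \sum_(b <- words n) F (f b))%R.
Proof.
move=> inj_f uniq_r mem_r; rewrite -(big_map f xpredT F); apply: perm_big.
apply: uniq_perm => // [|p]; first by rewrite map_inj_uniq ?words_uniq.
apply/idP/mapP => [/mem_r[b def_n <-]|[b b_n ->]].
  by exists b; rewrite // mem_words def_n.
by apply/mem_r; exists b => //; apply/eqP; rewrite -mem_words.
Qed.

(** * Odd Ferrers diagrams as words *)

Lemma mem_odd_parts b m :
  (m \in odd_parts b) = odd m && nth false b m./2.
Proof.
elim: b m => [|x b IHb] m /=; first by rewrite nth_nil andbF.
rewrite mem_cat mem_nseq.
case: m => [|[|m]] /=.
- by rewrite andbF orbF; apply/negP => /mapP[].
- rewrite andbT lt0b; case: x; rewrite ?orbT ?orbF //.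
  by apply/negP => /mapP[].
have inj2 : injective (addn 2) by exact: addnI.
by rewrite -[m.+2]/(2 + m) (mem_map inj2) IHb andbF orbF /= negbK.
Qed.

Lemma sorted_odd_parts b : sorted gtn (odd_parts b).
Proof.
have gtn_tr : transitive gtn by move=> i j k /=; lia.
elim: b => //= x b IHb.
have srt : sorted gtn (map (addn 2) (odd_parts b)).
  by rewrite sorted_map; apply: sub_sorted IHb => i j /=; lia.
case: x => /=; last by rewrite cats0.
rewrite cats1 -rev_sorted rev_rcons /= (path_sortedE (rev_trans gtn_tr)).
rewrite rev_sorted srt andbT all_rev all_map.
by apply/allP=> i; rewrite mem_odd_parts /=; lia.
Qed.

Definition ferrers_of_word (b : bitseq) := (size b, odd_parts b).

Lemma ferrers_of_word_inj : injective ferrers_of_word.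
Proof.
move=> b c [eq_sz eq_l]; apply: (@eq_from_nth _ false) => // i _.
have := mem_odd_parts c i.*2.+1; rewrite -eq_l mem_odd_parts.
by rewrite /= odd_double uphalf_double.
Qed.

Lemma is_Anu2P n F :
  is_Anu2 n F <-> exists2 b, weight b = n & ferrers_of_word b = F.
Proof.
split=> [|[b <- <-]].
  case: F => k l.
  case/andP=> /and4P[/and3P[srt_l l_gt0 _] odd_l le_l /eqP def_n] /= uniq_l.
  have srt_gt : sorted gtn l by rewrite (gtn_sorted_uniq_geq l) uniq_l.
  pose b := mkseq (fun i => i.*2.+1 \in l) k.
  have def_l : odd_parts b = l.
    have gtn_tr : transitive gtn by move=> i j h /=; lia.
    apply: (irr_sorted_eq gtn_tr _ (sorted_odd_parts b) srt_gt).
      by move=> i /=; apply: ltnn.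
    move=> m; rewrite mem_odd_parts.
    have [ltmk|lekm] := ltnP m./2 k.
      rewrite nth_mkseq //; case odd_m: (odd m) => /=; last first.
        by apply/esym/negP => /(allP odd_l); rewrite odd_m.
      by congr (_ \in l); lia.
    rewrite nth_default ?size_mkseq // andbF; apply/esym/negP => m_l.
    have := allP odd_l _ m_l; have /= := allP le_l _ m_l; lia.
  by exists b; rewrite /weight /ferrers_of_word def_l size_mkseq.
have srt := sorted_odd_parts b.
rewrite /is_Anu2 /is_odd_ferrers /ferrers_of_word /= /is_partition.
have/andP[-> ->]: uniq (odd_parts b) && sorted geq (odd_parts b).
  by rewrite -(gtn_sorted_uniq_geq (odd_parts b)).
rewrite !eqxx /= !andbT; apply/and3P; split; apply/allP=> m;
  rewrite mem_odd_parts => /andP[odd_m] //=.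
  by move: odd_m; case: m.
have [lt_m _|le_m] := ltnP m./2 (size b); first by lia.
by rewrite nth_default.
Qed.

(** * Partitions in Anu as words *)

(** The largest part is forced by the later letters: it is the least number of
its parity that exceeds all even parts of the rest. *)
Fixpoint anu_of_word (b : bitseq) : seq nat :=
  if b is x :: b' then ((ones b').*2.+1 + x) :: anu_of_word b' else [::].

Lemma anu_of_wordK : cancel anu_of_word (map (predC odd)).
Proof.
elim=> //= x b ->; congr (_ :: b).
by rewrite oddD /= odd_double; case: x.
Qed.

Lemma size_anu_of_word b : size (anu_of_word b) = size b.
Proof. by elim: b => //= x b ->. Qed.

Lemma count_odd_anu_of_word b : count odd (anu_of_word b) = zeros b.
Proof.
by elim: b => //= x b ->; rewrite oddD /= odd_double /zeros /=; case: x.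
Qed.

Lemma sumn_anu_of_word b : sumn (anu_of_word b) = weight b.
Proof. by elim: b => //= x b ->; rewrite weight_cons; lia. Qed.

Lemma anu_of_word_le b : all (geq (ones b).*2.+1) (anu_of_word b).
Proof.
elim: b => //= x b IHb; rewrite /ones /= -/(ones b).
apply/andP; split; first by case: x => /=; lia.
by apply: sub_all IHb => m /=; lia.
Qed.

Lemma mem_even_anu_of_word b m :
  ~~ odd m -> (m \in anu_of_word b) = (0 < m <= (ones b).*2).
Proof.
move=> even_m; elim: b => [|x b IHb] /=; first by case: m even_m.
by rewrite inE IHb /ones /= -/(ones b); case: x => /=; lia.
Qed.

Lemma is_Anu_of_word b : is_Anu (weight b) (anu_of_word b).
Proof.
rewrite /is_Anu /is_partition sumn_anu_of_word eqxx andbT -andbA.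
have geq_tr : transitive geq by move=> i j k /=; lia.
apply/and4P; split.
- elim: b => //= x b IHb; rewrite (path_sortedE geq_tr) IHb andbT.
  by apply: sub_all (anu_of_word_le b) => m /=; lia.
- by elim: b => //= x b ->; rewrite andbT; lia.
- elim: b => //= x b IHb; rewrite oddD /= odd_double.
  case: x => //=; rewrite IHb andbT mem_filter negb_and negbK.
  by rewrite mem_even_anu_of_word; lia.
apply/allP=> m m_b; apply/forallP=> j; apply/implyP=> /andP[j_gt0 even_j].
rewrite mem_even_anu_of_word // j_gt0 /=.
have /= := allP (anu_of_word_le b) m m_b; have := ltn_ord j; lia.
Qed.

(** Let [2 * N] be the largest even part after the first part [m], or 0 if
there is none.  The closure condition on even parts bounds [m] above by
[2 * N + 2], monotonicity bounds it below by [2 * N], and distinctness of the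
even parts excludes [m = 2 * N] if [N > 0]; so the parity of [m] determines
it. *)
Lemma is_Anu_inv n p :
  is_Anu n p -> anu_of_word (map (predC odd) p) = p.
Proof.
case/and3P=> /and3P[srt_p p_gt0 _] uniq_p /allP closed_p.
have geq_tr : transitive geq by move=> i j k /=; lia.
have {}closed_p m j : m \in p -> j < m -> 0 < j -> ~~ odd j -> j \in p.
  move=> /closed_p/forallP cl_m lt_jm j0 even_j.
  by have /implyP := cl_m (Ordinal lt_jm); rewrite /= j0; apply.
elim: p srt_p p_gt0 uniq_p closed_p => //= m p IHp.
rewrite (path_sortedE geq_tr) => /andP[ge_m srt_p] /andP[m_gt0 p_gt0].
move=> uniq_p closed_p; set b := map _ p.
have {IHp} def_p : anu_of_word b = p.
  apply: IHp => //; first by case: ifP uniq_p => _ //= /andP[].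
  move=> i j p_i lt_ji j0 even_j.
  have:= closed_p i j; rewrite !inE p_i orbT => /(_ isT lt_ji j0 even_j).
  by case/orP=> // /eqP def_j; have /= := allP ge_m i p_i; lia.
have memE j : ~~ odd j -> (j \in p) = (0 < j <= (ones b).*2).
  by move=> even_j; rewrite -def_p mem_even_anu_of_word.
rewrite def_p; congr (_ :: p).
have m_le : m <= (ones b).*2.+2.
  rewrite leqNgt; apply/negP => lt_m.
  have: (ones b).*2.+2 \in m :: p.
    by apply: (closed_p m); rewrite ?mem_head //= negbK odd_double.
  by rewrite inE memE; lia.
have m_ge : (ones b).*2 <= m.
  have [->//|ones_gt0] := posnP (ones b).
  suffices: (ones b).*2 \in p by move/(allP ge_m).
  by rewrite memE; lia.
case odd_m: (odd m) uniq_p => /=; first by lia.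
by rewrite mem_filter odd_m memE ?odd_m //=; lia.
Qed.

Lemma is_AnuP n p :
  is_Anu n p <-> exists2 b, weight b = n & anu_of_word b = p.
Proof.
split=> [Ap|[b <- <-]]; last exact: is_Anu_of_word.
exists (map (predC odd) p); last exact: is_Anu_inv Ap.
rewrite -sumn_anu_of_word (is_Anu_inv n) //.
by case/and3P: Ap => /and3P[_ _ /eqP].
Qed.

(** * Partitions in Bnu as words *)

(** Elements of [Bnu] listed in increasing order, so that the smallest part,
which governs the condition on the odd parts, comes first. *)
Definition ascending_bnu (s : seq nat) : bool :=
  [&& s != [::], sorted ltn s & all (fun m => odd m ==> (m < 2 * head 0 s)) s].

Lemma is_Bnu_rev s : is_Bnu (sumn s) (rev s) = ascending_bnu s.
Proof.
rewrite /is_Bnu /ascending_bnu sumn_rev eqxx rev_sorted all_rev.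
have -> : last 0 (rev s) = head 0 s.
  by case: s => //= k t; rewrite rev_cons last_rcons.
by rewrite -!size_eq0 size_rev.
Qed.

Definition max_odd (s : seq nat) := \max_(m <- s | odd m) m.

Lemma max_odd_mem s : has odd s -> (max_odd s \in s) && odd (max_odd s).
Proof.
elim: s => //= m s IHs; rewrite /max_odd big_cons inE -/(max_odd s).
case odd_m: (odd m) => /=; last by case/IHs/andP=> -> ->; rewrite orbT.
move=> _.
have [odd_s|no_odd] := boolP (has odd s).
  have /andP[s_o odd_o] := IHs odd_s.
  by rewrite /maxn; case: ifP; rewrite ?s_o ?odd_o ?orbT ?eqxx ?odd_m.
suff ->: max_odd s = 0 by rewrite maxn0 eqxx odd_m.
by apply: big_hasC.
Qed.

Lemma leq_max_odd s m : m \in s -> odd m -> m <= max_odd s.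
Proof. by move=> s_m odd_m; exact: (@leq_bigmax_seq _ s odd id). Qed.

(** Adding 1 to the smallest part and 2 to the others keeps every odd part
below twice the smallest part, and leaves a gap of at least 2 after the
smallest part, which is positive.  The true letter produces what this misses.
If all parts are even, adding 2 to each leaves room for a new part 0.
Otherwise the largest odd part [2 * j - 1] is increased by 2 and split into
the consecutive numbers [j] and [j + 1]: all parts exceed [j - 1], so the
other parts, increased by 2, are larger than [j + 1]. *)
Definition bnu_step (x : bool) (s : seq nat) : seq nat :=
  if ~~ x then
    if s is k :: t then k.+1 :: map (addn 2) t else [::]
  else if has odd s then
    let o := max_odd s in o./2.+1 :: o./2.+2 :: map (addn 2) (rem o s)
  else 0 :: map (addn 2) s.

Lemma sumn_rem o s : o \in s -> o + sumn (rem o s) = sumn s.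
Proof. by move/perm_to_rem/perm_sumn->. Qed.

Lemma size_bnu_step x s : s != [::] -> size (bnu_step x s) = size s + x.
Proof.
rewrite /bnu_step; case: x => /= [|_]; last first.
  by rewrite addn0; case: s => //= k t; rewrite size_map.
case: ifP => [/max_odd_mem/andP[s_o _] nz_s|_ _] /=; last first.
  by rewrite size_map addn1.
by rewrite size_map size_rem //; case: s nz_s {s_o} => //= *; lia.
Qed.

Lemma sumn_bnu_step x s : s != [::] ->
  sumn (bnu_step x s) = sumn s + 2 * (size s).-1 + 1 + x.
Proof.
rewrite /bnu_step; case: x => /=; last first.
  by case: s => //= k t _; rewrite sumn_map_add2; lia.
move=> nz_s; have {nz_s}: size s > 0 by case: s nz_s.
case: ifP => [/max_odd_mem/andP[s_o odd_o]|_] /=; rewrite sumn_map_add2.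
  have := sumn_rem _ _ s_o; rewrite size_rem //; clear s_o.
  by move: odd_o (size s) (sumn s) (sumn _); move: (max_odd s) => o; lia.
lia.
Qed.

Lemma sorted_map_add2 s : sorted ltn (map (addn 2) s) = sorted ltn s.
Proof. by rewrite sorted_map; apply: eq_sorted => i j /=. Qed.

Lemma map_add2_surj t : all (leq 2) t -> exists u, t = map (addn 2) u.
Proof.
elim: t => [|m t IHt] /=; first by exists [::].
by case/andP=> m2 /IHt[u ->]; exists (m - 2 :: u) => /=; rewrite subnKC.
Qed.

Lemma ascending_bnu_consP k t :
  reflect [/\ all (ltn k) t, sorted ltn t
            & all (fun m => odd m ==> (m < 2 * k)) t]
          (ascending_bnu (k :: t)).
Proof.
rewrite /ascending_bnu /= (path_sortedE ltn_trans) -andbA.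
apply: (iffP and4P) => [[? ? _ ?]|[? ? ?]]; split=> //.
by apply/implyP; lia.
Qed.

Lemma ascending_bnu_step x s : ascending_bnu s -> ascending_bnu (bnu_step x s).
Proof.
case: s => // k t asc_s; have [gt_t srt_t odd_t] := ascending_bnu_consP _ _ asc_s.
rewrite /bnu_step; case: x => [|/=]; last first.
  apply/ascending_bnu_consP; rewrite sorted_map_add2 !all_map; split=> //.
    by apply: sub_all gt_t => m /=; lia.
  by apply: sub_all odd_t => m /=; lia.
move: asc_s; set s := k :: t => /and3P[_ srt_s odd_s].
have ge_s m : m \in s -> k <= m.
  by rewrite inE => /predU1P[->|/(allP gt_t)] //=; lia.
have [/max_odd_mem/andP[s_o odd_o]|no_odd] := boolP (has odd s); last first.
  apply/ascending_bnu_consP; rewrite sorted_map_add2 !all_map; split=> //.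
    by apply/allP=> m /=.
  apply/allP=> m s_m /=; apply/implyP; rewrite negbK => odd_m.
  by case/hasP: no_odd; exists m.
set o := max_odd s in s_o odd_o *.
have uniq_s : uniq s by rewrite (sorted_uniq ltn_trans ltnn).
have o_lt : o < 2 * k by have /implyP := allP odd_s o s_o; apply.
have mem_r m : m \in rem o s -> (m != o) && (m \in s).
  by rewrite mem_rem_uniq.
apply/ascending_bnu_consP; split.
- rewrite /= ltnSn all_map; apply/allP=> m /mem_r/andP[_ /ge_s] /=; lia.
- rewrite /= (path_sortedE ltn_trans) sorted_map_add2 all_map.
  rewrite (subseq_sorted ltn_trans (rem_subseq o s)) // andbT.
  apply/allP=> m /mem_r/andP[_ /ge_s] /=; lia.
rewrite /= all_map; apply/andP; split; first by lia.
apply/allP=> m /mem_r/andP[m_o s_m] /=; apply/implyP; rewrite negbK => odd_m.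
by have := leq_max_odd _ _ s_m odd_m; rewrite -/o; lia.
Qed.

(** The shape of the two smallest parts tells which move to undo.  If they are
[k + 1] and [k + 2], their sum [2 * k + 3] goes back to the odd part
[2 * k + 1].  This is the largest odd part of the result since the other odd
parts were less than [2 * (k + 1)] before 2 was subtracted from them. *)
Lemma ascending_bnu_inv s : ascending_bnu s ->
  s = [:: 0] \/ exists x s', ascending_bnu s' /\ bnu_step x s' = s.
Proof.
case: s => // -[|k] t /ascending_bnu_consP[gt_t srt_t odd_t].
  (* With smallest part 0 there is no odd part, so all others are at least 2. *)
  have [u def_t] : exists u, t = map (addn 2) u.
    apply/map_add2_surj/allP=> m t_m.
    by have /= := allP gt_t m t_m; have /= := allP odd_t m t_m; lia.
  rewrite {t}def_t !(sorted_map_add2, all_map) in gt_t srt_t odd_t *.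
  case: u => [|m u] in gt_t srt_t odd_t *; [by left | right].
  have no_odd : has odd (m :: u) = false.
    apply/hasP=> -[j u_j odd_j]; have /= := allP odd_t j u_j; lia.
  exists true, (m :: u); rewrite /bnu_step no_odd; split=> //.
  apply/and3P; split=> //; apply/allP=> j u_j; apply/implyP=> odd_j.
  by case/hasP: no_odd; exists j.
right.
(* The case of consecutive smallest parts [k + 1] and [k + 2]. *)
have step_consecutive t' : t = k.+2 :: t' ->
    exists x s', ascending_bnu s' /\ bnu_step x s' = k.+1 :: t.
  move=> def_t; rewrite {t}def_t in gt_t srt_t odd_t *.
  move: srt_t => /=; rewrite (path_sortedE ltn_trans) => /andP[gt_t' srt_t'].
  have {odd_t gt_t} odd_t' : all (fun m => odd m ==> (m < 2 * k.+1)) t'.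
    by case/andP: odd_t.
  have [u def_t] : exists u, t' = map (addn 2) u.
    by apply/map_add2_surj; apply: sub_all gt_t' => m /=; lia.
  rewrite {t'}def_t !(sorted_map_add2, all_map) in gt_t' srt_t' odd_t' *.
  have ge_u m : m \in u -> k < m by move/(allP gt_t') => /=; lia.
  have odd_u m : m \in u -> odd m -> m < k.*2.
    by move/(allP odd_t') => /=; rewrite negbK => /implyP lt_m /lt_m; lia.
  (* The restored odd part can lie anywhere among the others, hence the sort. *)
  pose o := k.*2.+1; pose s := sort leq (o :: u).
  have s_ou : perm_eq s (o :: u) by rewrite perm_sort.
  have mem_s m : (m \in s) = (m == o) || (m \in u).
    by rewrite (perm_mem s_ou) inE.
  have notu_o : o \notin u by apply/negP => /odd_u; rewrite /o /= odd_double; lia.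
  have uniq_s : uniq s.
    rewrite (perm_uniq s_ou) /= notu_o (sorted_uniq ltn_trans) // => m.
    exact: ltnn.
  have srt_s : sorted ltn s.
    by rewrite ltn_sorted_uniq_leq uniq_s (sort_sorted leq_total).
  have odd_o : odd o by rewrite /= odd_double.
  have s_o : o \in s by rewrite mem_s eqxx.
  have odd_s : has odd s by apply/hasP; exists o.
  have max_o : max_odd s = o.
    apply/eqP; rewrite eqn_leq leq_max_odd // andbT.
    have /andP[] := max_odd_mem _ odd_s; rewrite mem_s.
    by case/predU1P=> [->|/odd_u lt_m /lt_m] //; rewrite /o; lia.
  have rem_o : rem o s = u.
    apply: (irr_sorted_eq ltn_trans ltnn) => //.
      exact: (subseq_sorted ltn_trans (rem_subseq o s)) srt_s.
    move=> m; rewrite mem_rem_uniq // !inE mem_s.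
    by case: eqP => [->|] //=; rewrite (negPf notu_o).
  exists true, s; split; last first.
    by rewrite /bnu_step odd_s max_o rem_o /o /= uphalf_double.
  have ge_s m : m \in s -> k < m.
    by rewrite mem_s => /predU1P[->|/ge_u] //; rewrite /o; lia.
  have le_s j : j \in s -> odd j -> j <= o.
    by rewrite mem_s => /predU1P[->|/odd_u lt_m /lt_m] //; rewrite /o; lia.
  apply/and3P; split=> //; first by case: (s) s_o.
  have /ge_s lt_hd : head 0 s \in s by case: (s) s_o => // *; apply: mem_head.
  by apply/allP=> m s_m; apply/implyP=> /(le_s _ s_m); rewrite /o; lia.
have [eq_hd|ne_hd] := eqVneq (head 0 t) k.+2.
  by case: t eq_hd step_consecutive {gt_t srt_t odd_t} => //= m t' -> /(_ _ erefl).
have lt_t : all (ltn k.+2) t.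
  (* Without consecutive smallest parts, subtracting 2 keeps [t] above [k]. *)
  case: t ne_hd gt_t srt_t {odd_t step_consecutive} => //= m t' ne_m /andP[lt_m _].
  rewrite (path_sortedE ltn_trans) => /andP[lt_t' _].
  apply/andP; split; first by lia.
  by apply: sub_all lt_t' => j /=; lia.
have [u def_t] : exists u, t = map (addn 2) u.
  by apply/map_add2_surj; apply: sub_all lt_t => m /=; lia.
clear gt_t ne_hd step_consecutive.
rewrite {t}def_t !(sorted_map_add2, all_map) in lt_t srt_t odd_t *.
exists false, (k :: u); split=> //; apply/ascending_bnu_consP; split=> //.
by apply: sub_all odd_t => m /=; lia.
Qed.

Fixpoint bnu_of_word (b : bitseq) : seq nat :=
  if b is x :: b' then bnu_step x (bnu_of_word b') else [:: 0].

Lemma ascending_bnu_of_word b : ascending_bnu (bnu_of_word b).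
Proof. by elim: b => //= x b; apply: ascending_bnu_step. Qed.

Lemma bnu_of_word_neq0 b : bnu_of_word b != [::].
Proof. by case/and3P: (ascending_bnu_of_word b). Qed.

Lemma size_bnu_of_word b : size (bnu_of_word b) = (ones b).+1.
Proof.
elim: b => //= x b IHb; rewrite size_bnu_step ?bnu_of_word_neq0 // IHb.
by rewrite /ones /=; lia.
Qed.

Lemma sumn_bnu_of_word b : sumn (bnu_of_word b) = weight b.
Proof.
elim: b => // x b IHb; rewrite weight_cons /= sumn_bnu_step ?bnu_of_word_neq0 //.
by rewrite IHb size_bnu_of_word.
Qed.

(** Which of the two moves produced [s]: only the true letter puts 0 first or
makes the two smallest parts consecutive. *)
Definition first_bit (s : seq nat) : bool :=
  if s is m0 :: m1 :: _ then (m0 == 0) || (m1 == m0.+1) else false.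

Lemma first_bit_bnu_step x s : ascending_bnu s -> first_bit (bnu_step x s) = x.
Proof.
case: s => // k t /ascending_bnu_consP[gt_t _ _].
case: x; rewrite /bnu_step.
  by case: ifP => _ //=; rewrite eqxx.
by case: t gt_t => //= m t /andP[]; lia.
Qed.

Lemma bnu_step_inj x s1 s2 : ascending_bnu s1 -> ascending_bnu s2 ->
  bnu_step x s1 = bnu_step x s2 -> s1 = s2.
Proof.
have inj2 : injective (addn 2) by exact: addnI.
move=> asc1 asc2; rewrite /bnu_step; case: x => /=; last first.
  case: s1 s2 asc1 asc2 => // k1 t1 [] // k2 t2 _ _ [->].
  by move/(inj_map inj2)->.
case: ifP => [/max_odd_mem/andP[s_o1 odd1]|_].
  case: ifP => [/max_odd_mem/andP[s_o2 odd2]|_ []//].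
  case=> eq_o _ /(inj_map inj2) eq_rem.
  have {}eq_o : max_odd s1 = max_odd s2 by lia.
  case/and3P: asc1 asc2 => _ srt1 _ /and3P[_ srt2 _].
  apply: (irr_sorted_eq ltn_trans ltnn) => //; apply: perm_mem.
  rewrite (permPl (perm_to_rem s_o1)) perm_sym (permPl (perm_to_rem s_o2)).
  by rewrite eq_rem eq_o.
by case: ifP => [_ [] //|_ [] /(inj_map inj2)].
Qed.

Lemma bnu_step_neq_singleton0 x s : ascending_bnu s -> bnu_step x s != [:: 0].
Proof.
case: s => // k t _; apply: contraPneq (sumn_bnu_step x (k :: t) isT) => ->.
by rewrite /=; lia.
Qed.

Lemma bnu_of_word_inj : injective bnu_of_word.
Proof.
elim=> [|x b IHb] [|y c] //= eq_bc.
- by have /eqP[] := bnu_step_neq_singleton0 y _ (ascending_bnu_of_word c).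
- by have /eqP[] := bnu_step_neq_singleton0 x _ (ascending_bnu_of_word b).
have eq_xy : x = y.
  by rewrite -(first_bit_bnu_step x _ (ascending_bnu_of_word b)) eq_bc
             first_bit_bnu_step // ascending_bnu_of_word.
rewrite -eq_xy in eq_bc *; congr (_ :: _); apply: IHb.
by apply: bnu_step_inj eq_bc; apply: ascending_bnu_of_word.
Qed.

(** Induction on the sum of the parts, which both moves increase. *)
Lemma bnu_of_word_surj s : ascending_bnu s -> exists b, bnu_of_word b = s.
Proof.
have [n] := ubnP (sumn s); elim: n s => // n IHn s lt_n.
case/ascending_bnu_inv=> [->|[x [s' [asc_s' def_s]]]]; first by exists [::].
have nz_s' : s' != [::] by case/and3P: asc_s'.
have [||b def_s'] := IHn s' => //.
  by move: lt_n; rewrite -def_s sumn_bnu_step //; lia.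
by exists (x :: b); rewrite /= def_s'.
Qed.

Lemma is_BnuP n p :
  is_Bnu n p <-> exists2 b, weight b = n & rev (bnu_of_word b) = p.
Proof.
split=> [Bp|[b <- <-]]; last first.
  by rewrite -sumn_bnu_of_word is_Bnu_rev ascending_bnu_of_word.
have sum_p : sumn p = n by case/and4P: Bp => _ _ /eqP.
have [|b def_b] := bnu_of_word_surj (rev p).
  by rewrite -is_Bnu_rev revK sumn_rev sum_p.
by exists b; rewrite -?sumn_bnu_of_word def_b ?revK ?sumn_rev.
Qed.

(** * Nonnegativity *)

Lemma zeros_eq0 b : zeros b = 0 -> b = nseq (size b) true.
Proof. by elim: b => //= -[] b // IHb /IHb {1}->. Qed.

Lemma weight_nseq_true k : weight (nseq k true) = k * k.+1.
Proof.
elim: k => // k IHk; rewrite [nseq _ _]/= weight_cons IHk /ones count_nseq /=.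
by lia.
Qed.

Lemma weight_nseq_false n : weight (nseq n false) = n.
Proof.
elim: n => // n IHn; rewrite [nseq _ _]/= weight_cons IHn /ones count_nseq /=.
by lia.
Qed.

(** The only possible negative term is that of the all-true word, and the
all-false word of length [n] makes up for it. *)
Lemma sum_zeros_ge0 n : 0 < n ->
  (0 <= \sum_(b <- words n) ((zeros b)%:Z - 1))%R.
Proof.
move=> n_gt0.
have [/hasP[b b_n /eqP z0]|no_z0] := boolP (has (fun b => zeros b == 0) (words n)).
  have uniq_z0 c : c \in words n -> zeros c = 0 -> c = b.
    move: b_n; rewrite !mem_words => /eqP wb /eqP wc zc.
    move: wb wc; rewrite (zeros_eq0 _ z0) (zeros_eq0 _ zc) !weight_nseq_true.
    by move=> wb wc; congr nseq; nia.
  have n_gt1 : 1 < n.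
    move: b_n; rewrite mem_words (zeros_eq0 _ z0) weight_nseq_true.
    by case: (size b) => [|k] /eqP; nia.
  pose c := nseq n false.
  have zc : zeros c = n by rewrite /zeros count_nseq /= mul1n.
  have c_n : c \in words n by rewrite mem_words weight_nseq_false.
  have ne_cb : c != b by apply: contraTneq n_gt1 => cb; rewrite -zc cb z0.
  have c_r : c \in rem b (words n) by rewrite mem_rem_uniq ?words_uniq // !inE ne_cb.
  have rest_ge0 : (0 <= \sum_(d <- rem c (rem b (words n))) ((zeros d)%:Z - 1))%R.
    rewrite big_seq sumr_ge0 // => d.
    rewrite mem_rem_uniq ?rem_uniq ?words_uniq // inE => /andP[_].
    rewrite mem_rem_uniq ?words_uniq // !inE => /andP[ne_db /uniq_z0 d_b].
    have : zeros d <> 0 by move/d_b/eqP; apply/negP.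
    by lia.
  rewrite (perm_big _ (perm_to_rem b_n)) big_cons.
  rewrite (perm_big _ (perm_to_rem c_r)) big_cons z0 zc /=.
  by move: rest_ge0; set rest := bigop.body _ _ _; lia.
rewrite big_seq sumr_ge0 // => b b_n.
have : zeros b != 0 by apply: contra no_z0 => zb; apply/hasP; exists b.
by lia.
Qed.

(** * Comparison of the three sums *)

Theorem theorem4p2 (n : nat) :
  (parts_excess n = \sum_(p <- Anu n) ((count odd p)%:Z - 1))%R /\
  (parts_excess n = \sum_(F <- Anu2 n) odd_ferrers_rank F)%R /\
  (0 < n -> (0 <= parts_excess n)%R).
Proof.
have sumA (F : seq nat -> int) :
    (\sum_(p <- Anu n) F p = \sum_(b <- words n) F (anu_of_word b))%R.
  apply: big_words _ _ _ _ _ (can_inj anu_of_wordK) (Anu_uniq n) _ => p.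
  by rewrite mem_Anu; apply: is_AnuP.
have sumB (F : seq nat -> int) :
    (\sum_(p <- Bnu n) F p = \sum_(b <- words n) F (rev (bnu_of_word b)))%R.
  have inj_f := inj_comp (can_inj revK) bnu_of_word_inj.
  apply: big_words _ _ _ _ _ inj_f (Bnu_uniq n) _ => p.
  by rewrite mem_Bnu; apply: is_BnuP.
have sumA2 (F : nat * seq nat -> int) :
    (\sum_(p <- Anu2 n) F p = \sum_(b <- words n) F (ferrers_of_word b))%R.
  apply: big_words _ _ _ _ _ ferrers_of_word_inj (Anu2_uniq n) _ => p.
  by rewrite mem_Anu2; apply: is_Anu2P.
have excessE : (parts_excess n = \sum_(b <- words n) ((zeros b)%:Z - 1))%R.
  rewrite /parts_excess sumA sumB -sumrB; apply: eq_bigr => b _.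
  by rewrite size_anu_of_word size_rev size_bnu_of_word -ones_zeros; lia.
split.
  by rewrite excessE sumA; apply: eq_bigr => b _; rewrite count_odd_anu_of_word.
split; last by rewrite excessE; apply: sum_zeros_ge0.
rewrite excessE sumA2; apply: eq_bigr => b _.
by rewrite /odd_ferrers_rank /= size_odd_parts -ones_zeros; lia.
Qed.
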